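(* Let $\lambda = \max_{\alpha >0} \frac{1-e^{-\alpha}}{2\sqrt{\alpha}}$. Let $l=l(r)$ be a function from positive integers to positive integers such that $l(r)/\sqrt{\log r}\to\infty$ and $l(r)\log\log r/\log r\to 0$ as $r\to\infty$. Then $$c_\infty(lK_r) \geq lr + (1-o(1))\frac{\lambda^2 r\log r}{4l},$$ that is, for every $\eta>0$ there is $r_0$ such that for all $r\ge r_0$, $c_\infty(l(r)K_r) \ge l(r)\,r + (1-\eta)\frac{\lambda^2 r\log r}{4l(r)}$.
   Context: All graphs are finite and simple. $K_r$ is the complete graph on $r$ vertices and $lK_r$ the disjoint union of $l$ copies of $K_r$. A graph $H$ is a minor of $G$ if a graph isomorphic to $H$ can be obtained from a subgraph of $G$ by contracting edges. For a non-null graph $G$, $d(G)=e(G)/v(G)$. For a graph $H$, $c_\infty(H)=\lim_{n\to\infty}\max d(G)$, the maximum over all graphs $G$ on $n$ vertices not containing $H$ as a minor. $\log$ is the natural logarithm. *)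

(* Defs.v *)
From HB Require Import structures.
From Stdlib Require Import Reals Lra.
From Coquelicot Require Import Coquelicot.
From mathcomp Require Import all_boot boolp.

Set Implicit Arguments.
Unset Strict Implicit.
Unset Printing Implicit Defensive.

(* A simple graph on V is a set of two-element subsets of V. *)
Structure graph (V : finType) := Graph {
  edges : {set {set V}};
  edgesP : [forall e in edges, #|e| == 2%N] }.

HB.instance Definition _ (V : finType) := [isSub for @edges V].
HB.instance Definition _ (V : finType) := [Finite of graph V by <:].

Lemma complete_subproof (V : finType) :
  [forall e in [set e : {set V} | #|e| == 2%N], #|e| == 2%N].
Proof. by apply/forall_inP => e; rewrite inE. Qed.

Definition complete (V : finType) : graph V := Graph (complete_subproof V).

Lemma copies_subproof (l : nat) (V : finType) (H : graph V) :
  [forall e in [set [set (i, x) | x in e] | i : 'I_l, e : {set V} in edges H],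
     #|e| == 2%N].
Proof.
apply/forall_inP => _ /imset2P[i e _ eH ->].
rewrite card_imset; last by move=> x y [].
exact: (forall_inP (edgesP H)).
Qed.

(* The disjoint union of l copies of H. *)
Definition copies (l : nat) (V : finType) (H : graph V) : graph ('I_l * V)%type :=
  Graph (copies_subproof l H).

Definition isomorphic (U V : finType) (H : graph U) (G : graph V) : Prop :=
  exists2 f : U -> V, bijective f &
    edges G = [set f @: e | e : {set U} in edges H].

Definition subgraph (V : finType) (A : {set V}) (S : graph {x | x \in A})
    (G : graph V) : Prop :=
  forall e : {set {x | x \in A}}, e \in edges S -> val @: e \in edges G.

(* G' is G with the edge xy contracted: f identifies x with y and nothing
   else; loops and multiple edges do not appear in the image set. *)
Definition edge_contraction (V W : finType) (G : graph V) (G' : graph W) : Prop :=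
  exists (x y : V) (f : V -> W),
    [/\ [set x; y] \in edges G,
        forall w, exists u, f u = w,
        forall u v, f u = f v <->
          u = v \/ (u \in [set x; y] /\ v \in [set x; y]) &
        edges G' = [set f @: e | e : {set V} in edges G :\ [set x; y]]].

Inductive contracts_to (V : finType) (G : graph V) :
    forall W : finType, graph W -> Prop :=
| contracts_refl : contracts_to G G
| contracts_step (W W' : finType) (G1 : graph W) (G2 : graph W') :
    contracts_to G G1 -> edge_contraction G1 G2 -> contracts_to G G2.

Definition minor (U V : finType) (H : graph U) (G : graph V) : Prop :=
  exists (A : {set V}) (S : graph {x | x \in A}) (W : finType) (C : graph W),
    [/\ subgraph S G, contracts_to S C & isomorphic C H].

Local Open Scope R_scope.

Definition density (V : finType) (G : graph V) : R :=
  INR #|edges G| / INR #|V|.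

(* Densities are nonnegative, so the neutral element 0 only matters when no
   graph on n vertices is H-minor-free. *)
Definition max_density (U : finType) (H : graph U) (n : nat) : R :=
  \big[Rmax/0]_(G : graph 'I_n | `[< ~ minor H G >]) density G.

(* Lim_seq is total and equals the limit when that exists; for max_density H
   the existence of the limit is a known theorem. *)
Definition c_infty (U : finType) (H : graph U) : Rbar :=
  Lim_seq (max_density H).

Definition is_max_on_pos (g : R -> R) (m : R) : Prop :=
  (exists2 a : R, 0 < a & g a = m) /\ (forall a : R, 0 < a -> g a <= m).

Definition lambda_fun (a : R) : R := (1 - exp (- a)) / (2 * sqrt a).

Lemma lambda_max_exists : exists lambda : R, is_max_on_pos lambda_fun lambda.
Proof.
have gmaj a : 0 < a -> lambda_fun a <= sqrt a / 2 /\ lambda_fun a <= / (2 * sqrt a).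
  move=> a0; have s0 := sqrt_lt_R0 _ a0; have ss := sqrt_sqrt a (Rlt_le _ _ a0).
  have e1 := exp_ineq1_le (- a); have e2 := exp_pos (- a).
  rewrite /lambda_fun; split.
    apply: (Rmult_le_reg_r (2 * sqrt a)); first lra.
    have -> : (1 - exp (- a)) / (2 * sqrt a) * (2 * sqrt a) = 1 - exp (- a)
      by field; lra.
    have -> : sqrt a / 2 * (2 * sqrt a) = sqrt a * sqrt a by field.
    lra.
  rewrite /Rdiv -[X in _ <= X]Rmult_1_l.
  apply: Rmult_le_compat_r; last lra.
  by apply: Rlt_le; apply: Rinv_0_lt_compat; lra.
have g1 : 1 / 4 <= lambda_fun 1.
  rewrite /lambda_fun sqrt_1 exp_Ropp.
  have e1 := exp_ineq1_le 1.
  have : / exp 1 <= / 2 by apply: Rinv_le_contravar; lra.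
  lra.
have [M [MH MI]] : exists M, (forall a, / 16 <= a <= 16 ->
    lambda_fun a <= lambda_fun M) /\ / 16 <= M <= 16.
  apply: continuity_ab_maj; first lra.
  move=> a [a1 a2]; apply: derivable_continuous_pt; apply: ex_derive_Reals_0.
  rewrite /lambda_fun; auto_derive.
  have s0 : 0 < sqrt a by apply: sqrt_lt_R0; lra.
  by repeat split; lra.
exists (lambda_fun M); split; first by exists M => //; lra.
move=> a a0; have gM : 1 / 4 <= lambda_fun M
  by apply: Rle_trans g1 (MH 1 _); lra.
have s16 : sqrt 16 = 4 by rewrite (_ : 16 = 4 * 4) ?sqrt_square; lra.
have s0 := sqrt_lt_R0 _ a0; have [h1 h2] := gmaj a a0.
case: (Rle_lt_dec (/ 16) a) => ha; last first.
  have : sqrt a <= / 4.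
    have -> : / 4 = sqrt (/ 16) by rewrite -s16 sqrt_inv.
    by apply: sqrt_le_1_alt; lra.
  lra.
case: (Rle_lt_dec a 16) => hb; first by apply: MH.
have s4 : 4 <= sqrt a by rewrite -s16; apply: sqrt_le_1_alt; lra.
have : / (2 * sqrt a) <= / 8 by apply: Rinv_le_contravar; lra.
lra.
Qed.

(* Main.v *)
(* Let X be an independent set of x = l (r - s) - 1 vertices and attach to it
   arbitrarily many copies of one graph F on M vertices, so that the density
   tends to the number of edges sent from X to F plus those inside F, divided
   by M. Choose the pairs of X x F with probability 1 - 1/K (K about 2 log^2 r)
   and those of F with probability 1/2. In an l K_r minor some K_r uses fewer
   than r - s vertices of X, so more than s of its branch sets avoid X; being
   connected and pairwise adjacent they lie in one copy of F. Nearly all other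
   branch sets meet X at most once, so they need many vertices of F to be
   adjacent to the first ones: by AM-GM the product of the average sizes of the
   two kinds of sets is at most M^2 / (4 s (r - s)), and a union bound shows
   that a random choice admits no such configuration as soon as M^2 is a little
   smaller than 4 s r log r / log 2. With M = 0.4 r log r / l and s = 0.06 r
   log r / l^2 the gain over l r is at least r log r / (27 l), and lambda^2 <=
   4/27. *)
Require Import Defs.
From Stdlib Require Import Reals Lra.
From Coquelicot Require Import Coquelicot.
From mathcomp Require Import all_boot ssralg zmodp zify boolp.

Set Implicit Arguments.
Unset Strict Implicit.
Unset Printing Implicit Defensive.

Local Open Scope nat_scope.

(** * Branch sets *)

Definition adj (V : finType) (G : graph V) (u v : V) : bool :=
  [set u; v] \in edges G.

Lemma adjC (V : finType) (G : graph V) : symmetric (adj G).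
Proof. by move=> u v; rewrite /adj setUC. Qed.

Lemma edge_pair (V : finType) (G : graph V) (e : {set V}) : e \in edges G ->
  exists u v, [/\ u != v, e = [set u; v] & adj G u v].
Proof.
move=> eG; have /cards2P[u [v [uv E]]] := forall_inP (edgesP G) _ eG.
by exists u, v; split; rewrite // /adj -E.
Qed.

(* Connectedness of the subgraph induced on A, as the absence of a 2-colouring
   of A that is constant along edges and not constant. *)
Definition conn (V : finType) (G : graph V) (A : {set V}) : Prop :=
  forall P : V -> bool,
    (forall u v, u \in A -> v \in A -> adj G u v -> P u = P v) ->
    forall u v, u \in A -> v \in A -> P u = P v.

Lemma set2_inj (V : finType) (a b c d : V) :
  [set a; b] = [set c; d] -> (a = c /\ b = d) \/ (a = d /\ b = c).
Proof.
move=> E.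
have: a \in [set c; d] by rewrite -E set21.
have: b \in [set c; d] by rewrite -E set22.
have: c \in [set a; b] by rewrite E set21.
have: d \in [set a; b] by rewrite E set22.
by rewrite !inE => /orP[]/eqP ? /orP[]/eqP ? /orP[]/eqP ? /orP[]/eqP ?; subst; auto.
Qed.

(** Induction on the contractions: the fibre over a merged vertex is the union of the fibres over
    [x] and [y], and a lift [a], [b] of the contracted edge joins these two connected sets. *)
Lemma contracts_to_fibers (V W : finType) (G : graph V) (C : graph W) :
  contracts_to G C ->
  exists phi : V -> W,
    [/\ forall w, exists v, phi v = w,
        forall w, conn G [set v | phi v == w] &
        forall w w', adj C w w' ->
          exists u v, [/\ phi u = w, phi v = w' & adj G u v]].
Proof.
elim=> {W C} [|W1 W' G1 G2 _ [phi [psurj pconn padj]] [x [y [f [xy fsurj fE eE]]]]].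
  exists id; split=> [w|w P _ u v|w w' ww']; first by exists w.
    by rewrite !inE => /eqP-> /eqP->.
  by exists w, w'.
exists (f \o phi); split=> [w|w P HP|w w'].
- by have [w1 <-] := fsurj w; have [v <-] := psurj w1; exists v.
- have Pf (u v : V) : phi u = phi v -> f (phi u) = w -> P u = P v.
    move=> uv fu; apply: (pconn (phi v)); rewrite ?inE ?uv //.
    by move=> a b; rewrite !inE => /eqP au /eqP bv; apply: HP;
      rewrite inE /= ?au ?bv -?uv fu.
  have [a [b [ax bY ab]]] := padj _ _ xy.
  have Pxy (u v : V) : phi u = x -> phi v = y -> f x = w -> P u = P v.
    move=> ux vy fx.
    have fyx : f y = f x by apply/fE; right; rewrite set21 set22.
    rewrite (Pf u a) ?ux ?ax // (Pf v b) ?vy ?bY ?fyx //.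
    by apply: HP => //; rewrite inE /= ?ax ?bY ?fyx fx.
  move=> u v; rewrite !inE /= => /eqP fu /eqP fv.
  have /fE[uv|[]] : f (phi u) = f (phi v) by rewrite fu fv.
    exact: Pf.
  rewrite !inE => /orP[]/eqP Eu /orP[]/eqP Ev.
  + by apply: Pf; rewrite ?Eu ?Ev // -Eu.
  + by apply: Pxy; rewrite // -Eu.
  + by apply/esym/Pxy; rewrite // -Ev.
  + by apply: Pf; rewrite ?Eu ?Ev // -Eu.
- rewrite /adj eE => /imsetP[e]; rewrite inE => /andP[_ /edge_pair[a [b [_ -> ab]]]].
  have [u [v [ua vb uv]]] := padj _ _ ab.
  rewrite imsetU !imset_set1 => /set2_inj[[-> ->]|[-> ->]].
    by exists u, v; rewrite /= ua vb.
  by exists v, u; rewrite /= ua vb -/(adj G v u) adjC.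
Qed.

Lemma adj_copies_complete (l r : nat) (i : 'I_l) (j j' : 'I_r) : j != j' ->
  adj (copies l (complete 'I_r)) (i, j) (i, j').
Proof.
move=> jj'; apply/imset2P; exists i [set j; j'] => //; first by rewrite !inE cards2 jj'.
by rewrite imsetU !imset_set1.
Qed.

(** The branch set for [(i, j)] is the fibre over the vertex of [C] that the isomorphism sends to
    [(i, j)], pushed into [V] by [val]. *)
Lemma minor_copies_complete (V : finType) (G : graph V) (l r : nat) :
  minor (copies l (complete 'I_r)) G ->
  exists beta : 'I_l -> 'I_r -> {set V},
    [/\ forall i j i' j' v, v \in beta i j -> v \in beta i' j' -> i = i' /\ j = j',
        forall i j, exists v, v \in beta i j,
        forall i j, conn G (beta i j) &
        forall i j j', j != j' ->
          exists u v, [/\ u \in beta i j, v \in beta i j' & adj G u v]].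
Proof.
case=> A [S [W [C [SG /contracts_to_fibers[phi [psurj pconn padj]] [g gbij gE]]]]].
have [g' gK g'K] := gbij.
have SG2 a b : adj S a b -> adj G (val a) (val b).
  by move=> /SG; rewrite imsetU !imset_set1.
exists (fun i j => [set val a | a in [set a | phi a == g' (i, j)]]).
split=> [i j i' j' v|i j|i j P HP|i j j' jj'].
- case/imsetP=> a; rewrite inE => /eqP pa -> /imsetP[b]; rewrite inE => /eqP pb.
  move/val_inj=> ab; move: pa; rewrite ab pb => /(can_inj g'K)[-> ->]; auto.
- have [a pa] := psurj (g' (i, j)).
  by exists (val a); apply/imsetP; exists a; rewrite // inE pa.
- have H := pconn (g' (i, j)) (P \o val).
  move=> _ _ /imsetP[a pa ->] /imsetP[b pb ->].
  apply: H pa pb => u v pu pv /SG2 uv.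
  by apply: HP => //; apply/imsetP; [exists u|exists v].
- have := adj_copies_complete i jj'; rewrite /adj gE => /imsetP[e eC].
  have /edge_pair[a [b [_ -> ab]]] := eC.
  have [u [v [ua vb uv]]] := padj _ _ ab.
  have H : [set (i, j); (i, j')] = [set g a; g b] ->
      exists u v, [/\ u \in [set sval a | a in [set a | phi a == g' (i, j)]], v \in [set sval a | a in [set a | phi a == g' (i, j')]] & adj G u v].
    have In j1 w d : (i, j1) = g w -> phi d = w ->
        sval d \in [set sval a | a in [set a | phi a == g' (i, j1)]].
      by move=> E dw; apply/imsetP; exists d; rewrite // inE E gK dw.
    case/set2_inj => -[E1 E2].
      by exists (val u), (val v); split; [apply: In E1 ua|apply: In E2 vb|exact: SG2].
    exists (val v), (val u).
    by split; [apply: In E1 vb|apply: In E2 ua|rewrite adjC; exact: SG2].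
  by rewrite imsetU !imset_set1 => /H.
Qed.

(** * Counting labellings *)

Lemma eq_card_setP (T : finType) (A B : {set T}) : A = B -> #|A| = #|B|.
Proof. by move->. Qed.

Section Counting.
Variables (T L : finType).
Implicit Types (f : {ffun T -> L}) (E : {set {ffun T -> L}}) (S : {set T}).

Definition upd f t l : {ffun T -> L} := [ffun t' => if t' == t then l else f t'].

Definition indep_of E S := forall t f l, t \in S -> (upd f t l \in E) = (f \in E).

Lemma updE f t l : upd f t l t = l.
Proof. by rewrite ffunE eqxx. Qed.

Lemma upd_other f t l t' : t' != t -> upd f t l t' = f t'.
Proof. by rewrite ffunE => /negPf->. Qed.

(** Swapping the label at [t] with a spare label is an involution on pairs (labelling, label). It
    leaves membership in [E] unchanged and turns the condition on [f t] into one on the spare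
    label. *)
Lemma card_coordinate E t (A : {set L}) : indep_of E [set t] ->
  #|[set f in E | f t \in A]| * #|L| = #|E| * #|A|.
Proof.
move=> Et.
pose sw (p : {ffun T -> L} * L) := (upd p.1 t p.2, p.1 t).
have swK : involutive sw.
  case=> f l; rewrite /sw /= updE; congr pair.
  by apply/ffunP => t'; rewrite !ffunE; case: eqP => // ->.
rewrite -[#|L|]cardsT -!cardsX -(card_imset _ (inv_inj swK)); apply: eq_card_setP; apply/setP => -[f l].
rewrite (can2_imset_pre _ swK swK) !inE /= updE Et ?inE // andbT; by [].
Qed.

Variable Z : T -> {set L}.
Definition all_in S f := [forall t in S, f t \in Z t].

Lemma all_in_upd S f t l : t \notin S -> all_in S (upd f t l) = all_in S f.
Proof.
move=> tS; apply: eq_forallb_in => t' t'S.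
by rewrite upd_other //; apply: contraNneq tS => <-.
Qed.

Lemma card_all_in E S : indep_of E S ->
  #|[set f in E | all_in S f]| * #|L| ^ #|S| = #|E| * \prod_(t in S) #|Z t|.
Proof.
elim: {S}#|S| {-2}S (erefl #|S|) => [|n IH] S.
  move/eqP; rewrite cards_eq0 => /eqP-> _; rewrite cards0 big_set0 !muln1.
  apply: eq_card_setP; apply/setP => f; rewrite !inE; case: (f \in E) => //=.
  by apply/forall_inP => t; rewrite inE.
move=> Sn ES; have /card_gt0P[t tS] : 0 < #|S| by rewrite Sn.
have Dn : #|S :\ t| = n by move: Sn; rewrite (cardsD1 t) tS => -[].
have := IH _ Dn (fun t' f l H => ES t' f l (subsetP (subsetDl _ _) _ H)).
rewrite (big_setD1 t tS) /= => H.
have := @card_coordinate [set f in E | all_in (S :\ t) f] t (Z t).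
have -> : [set f in [set f in E | all_in (S :\ t) f] | f t \in Z t]
   = [set f in E | all_in S f].
  apply/setP => f; rewrite !inE -andbA; congr (_ && _).
  apply/andP/forall_inP => [[/forall_inP H1 H2] t' t'S|H1].
    by case: (eqVneq t' t) => [->//|tt]; apply: H1; rewrite !inE tt.
  by split; [apply/forall_inP => t' /setD1P[_ /H1]|apply: H1].
set e' := #|_|; rewrite -/e' => H2; rewrite Dn in H.
have {}H2 : e' * #|L| = #|[set f in E | all_in (S :\ t) f]| * #|Z t|.
  apply: H2 => t' f l; rewrite !inE => /eqP->.
  by rewrite ES // all_in_upd // !inE eqxx.
by rewrite Sn expnS mulnA H2 mulnAC H mulnAC mulnA.
Qed.

(* Division-free form of: disjoint blocks give independent events, each of
   probability at most 1 - 1/Q. *)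
Lemma card_blocks (I : eqType) (ks : seq I) (S : I -> {set T}) (Q : nat) :
  uniq ks ->
  {in ks &, forall k k', k != k' -> [disjoint S k & S k']} ->
  {in ks, forall k, #|L| ^ #|S k| <= Q * \prod_(t in S k) #|Z t|} ->
  0 < #|L| ->
  #|[set f | all (fun k => ~~ all_in (S k) f) ks]| * Q ^ size ks
    <= #|L| ^ #|T| * Q.-1 ^ size ks.
Proof.
move=> Uks Dks Qks L0; elim: ks Uks Dks Qks => [|k ks IH] /=.
  by move=> _ _ _; rewrite !muln1 -card_ffun max_card.
case/andP=> kks Uks Dks Qks.
set E := [set f | all _ ks] in IH.
have {}IH := IH Uks (sub_in2 (fun x h => @mem_behead _ (k :: ks) x h) Dks)
   (sub_in1 (fun x h => @mem_behead _ (k :: ks) x h) Qks).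
have EI : indep_of E (S k).
  move=> t f l tk; rewrite !inE; apply: eq_in_all => k' k'ks; rewrite all_in_upd //.
  have kk' : k != k' by apply: contraNneq kks => ->.
  have := Dks k k' (mem_head _ _) (mem_behead (s := k :: ks) k'ks) kk'.
  by move=> /disjointFr->.
have := card_all_in EI; have := Qks k (mem_head _ _).
have -> : [set f | ~~ all_in (S k) f && all (fun k => ~~ all_in (S k) f) ks]
   = E :\: [set f in E | all_in (S k) f].
  by apply/setP => f; rewrite !inE; case: (all_in _ _) => /=; rewrite ?andbT ?andbF //; case: (all _ _).
rewrite cardsD; set E' := [set f in E | _].
have -> : E :&: E' = E' by apply/setIidPr/subsetP => f; rewrite !inE => /andP[].
have LS : 0 < #|L| ^ #|S k| by rewrite expn_gt0 L0.
(* The block lies in [Z] for at least a fraction 1/Q of [E], so removing these labellings leaves at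
   most a fraction 1 - 1/Q. *)
move=> HQ HE; have HQE : #|E| <= Q * #|E'|.
  by rewrite -(leq_pmul2r LS) -mulnA HE mulnCA leq_mul2l HQ orbT.
have H1 : (#|E| - #|E'|) * Q <= #|E| * Q.-1 by case: (Q) HQE => *; nia.
rewrite !expnS; move: (Q ^ size ks) (Q.-1 ^ size ks) IH => u v IH.
rewrite mulnA; apply: (leq_trans (leq_mul H1 (leqnn u))).
by rewrite mulnAC [Q.-1 * v]mulnC mulnA leq_mul2r IH orbT.
Qed.

End Counting.

(** Markov's inequality: values above 5/4 of the average occur on at most 4/5 of [S]. *)
Lemma markov_size (I : finType) (S : {set I}) (b : I -> nat) :
  #|S| <= 5 * #|[set i in S | 4 * (b i * #|S|) <= 5 * \sum_(i in S) b i]|.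
Proof.
set s := \sum_(i in S) b i; set S' := [set i in S | _].
have : \sum_(i in S :\: S') (5 * s).+1 <= \sum_(i in S :\: S') 4 * (b i * #|S|).
  by apply: leq_sum => i; rewrite !inE => /andP[]; case: (i \in S) => //=; rewrite -ltnNge.
rewrite sum_nat_const -big_distrr -big_distrl /=.
have : \sum_(i in S :\: S') b i <= s.
  by rewrite /s [X in _ <= X](big_setID S') /= leq_addl.
have : #|S :\: S'| + #|S'| = #|S|.
  by rewrite -[RHS](cardsID S') addnC; congr (_ + _); congr #|pred_of_set _|; apply/esym/setIidPr/subsetP => i; rewrite inE => /andP[].
by nia.
Qed.

(** * Random labellings *)

Lemma card_bigcup_le (I T : finType) (F : I -> {set T}) (P : pred I) :
  #|\bigcup_(i | P i) F i| <= \sum_(i | P i) #|F i|.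
Proof.
elim/big_rec2: _ => [|i n A _ IH]; first by rewrite cards0.
by apply: leq_trans (leq_card_setU _ _) _; rewrite leq_add2l.
Qed.

Section Labelling.
Variables (x m h r : nat).

Notation X := 'I_x.
Notation F := 'I_m.+1.
Notation lab := 'I_(h.*2.+1).+1.
Notation K := (h.*2.+1).+1.
(* A pair inside F is the set of its ends; slots [inr e] with #|e| <> 2 are
   labelled but never used. *)
Definition slot : finType := (X * F + {set F})%type.
Implicit Types (f : {ffun slot -> lab}) (hF : {ffun F -> option 'I_r})
  (chi : {ffun 'I_r -> option X}) (SB SJ : {set 'I_r}).

(** One uniform label set of even size [K] = 2 (h + 1) realises both probabilities of absence: 1/K
    between X and F, exactly 1/2 inside F. *)
Definition absent (t : slot) : {set lab} :=
  if t is inl _ then [set ord0] else [set k : lab | k < h.+1].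

Definition is_slot (t : slot) := if t is inr e then #|e| == 2 else true.

Definition present f := [set t | is_slot t & f t \notin absent t].

Definition fib hF i := [set a | hF a == Some i].

(** These are the pairs that could join branch set [i], which avoids X, to branch set [j], which has
    at most the vertex [chi j] in X; hence the asymmetry. *)
Definition block hF chi i j : {set slot} :=
  [set t : slot | match t with
    | inl (y, a) => (hF a == Some i) && (chi j == Some y)
    | inr e => [exists a, exists b,
        [&& hF a == Some i, hF b == Some j & e == [set a; b]]]
    end].

Variables D beta gam : nat.

(* In (hF, chi, (SB, SJ)), hF maps a vertex of F to the branch set containing it,
   chi j is the vertex of X in branch set j, SB indexes branch sets that avoid X
   and SJ branch sets that should all be adjacent to those of SB. *)
Definition config : finType :=
  ({ffun F -> option 'I_r} * {ffun 'I_r -> option X} * ({set 'I_r} * {set 'I_r}))%type.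

(** The first two conditions make the blocks disjoint, the third provides at least [D] of them, and
    the last makes each one entirely absent with probability at least 1/Q. *)
Definition admissible (p : config) :=
  let: (hF, chi, (SB, SJ)) := p in
  [&& [disjoint SB & SJ],
      [forall j in SJ, forall j' in SJ,
         (chi j == chi j') && (chi j != None) ==> (j == j')],
      D <= #|SB| * #|SJ| &
      [forall i in SB, forall j in SJ,
         (#|fib hF i| <= beta) && (#|fib hF i| * #|fib hF j| <= gam)]].

Definition realised f (p : config) :=
  let: (hF, chi, (SB, SJ)) := p in
  all (fun k => ~~ all_in absent (block hF chi k.1 k.2) f) (enum (setX SB SJ)).

Let Q := K ^ beta * 2 ^ gam.

Lemma card_absent t : #|absent t| = if t is inl _ then 1 else h.+1.
Proof.
case: t => [t|e]; first by rewrite /absent cards1.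
have le : h.+1 <= K by rewrite ltnS leqW // -addnn leq_addr.
have wi : injective (widen_ord le) by move=> a b /(congr1 val)/= /val_inj.
rewrite -[RHS]card_ord -cardsT -(card_imset _ wi).
apply: eq_card_setP; apply/setP => k; rewrite inE; apply/idP/imsetP.
  by move=> kh; exists (Ordinal kh) => //; apply: val_inj.
by case=> k' _ ->; rewrite /= ltn_ord.
Qed.

(** An absent slot costs a factor [K] between X and F and a factor 2 inside F. The block has at most
    [#|fib hF i|] slots of the first kind, as [chi j] is a single vertex, and at most
    [#|fib hF i| * #|fib hF j|] of the second. *)
Lemma card_block_weight hF chi i j :
  #|fib hF i| <= beta -> #|fib hF i| * #|fib hF j| <= gam ->
  #|{: lab}| ^ #|block hF chi i j| <= Q * \prod_(t in block hF chi i j) #|absent t|.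
Proof.
move=> Hb Hg; set S := block _ _ _ _.
pose il (t : slot) := if t is inl _ then true else false.
rewrite -prod_nat_const card_ord.
have -> : \prod_(t in S) K = \prod_(t in S) ((if il t then K else 2) * #|absent t|).
  apply: eq_bigr => t _; rewrite card_absent; case: t => /= _; first by rewrite muln1.
  by rewrite mul2n doubleS.
rewrite big_split leq_mul2r; apply/orP; right.
rewrite (bigID il) /= /Q; apply: leq_mul.
  rewrite [X in X <= _](_ : _ = \prod_(t in [set t in S | il t]) K); last first.
    by apply: eq_big => t; [rewrite inE|case/andP=> _ ->].
  rewrite prod_nat_const leq_pexp2l //.
  apply: leq_trans Hb; case E: (chi j) => [y|].
    apply: leq_trans (leq_imset_card (fun a => inl (y, a)) _).
    apply/subset_leq_card/subsetP => -[[y' a]|e]; rewrite !inE ?andbF //= E andbT.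
    by case/andP=> hFa /eqP[->]; apply/imsetP; exists a; rewrite ?inE.
  rewrite (_ : [set _ in S | _] = set0) ?cards0 //.
  by apply/setP => -[[y' a]|e]; rewrite !inE ?andbF //= E andbT andbF.
rewrite [X in X <= _](_ : _ = \prod_(t in [set t in S | ~~ il t]) 2); last first.
  by apply: eq_big => t; [rewrite inE|case/andP=> _ /negPf->].
rewrite prod_nat_const leq_pexp2l //; apply: leq_trans Hg; rewrite -cardsX.
apply: leq_trans (leq_imset_card (fun ab : F * F => inr [set ab.1; ab.2]) _).
apply/subset_leq_card/subsetP => -[[y a]|e]; rewrite !inE ?andbF //= andbT.
case/existsP=> a /existsP[b /and3P[hFa hFb /eqP->]].
by apply/imsetP; exists (a, b); rewrite ?inE ?hFa.
Qed.

(** A slot determines its block: the end in a class of [SB] gives [i], and the other end gives [j]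
    through [chi] or [hF]. Disjointness of [SB] and [SJ] prevents the two ends of a pair in F from
    trading roles. *)
Lemma block_disjoint hF chi SB SJ : [disjoint SB & SJ] ->
  {in SJ &, forall j j', chi j = chi j' -> chi j != None -> j = j'} ->
  {in setX SB SJ &, forall k k', k != k' ->
     [disjoint block hF chi k.1 k.2 & block hF chi k'.1 k'.2]}.
Proof.
move=> dBJ chiI [i j] [i' j'] /setXP[iB jJ] /setXP[i'B j'J] /=; apply: contraNT.
rewrite -setI_eq0 => /set0Pn[[[y a]|e]]; rewrite !inE.
  case/andP=> /andP[/eqP hi /eqP cj] /andP[/eqP hi' /eqP cj'].
  have [->] : Some i = Some i' by rewrite -hi.
  by rewrite (chiI _ _ jJ j'J) ?cj ?cj'.
case/andP=> /existsP[a /existsP[b /and3P[/eqP hi /eqP hj /eqP->]]].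
case/existsP=> a' /existsP[b' /and3P[/eqP hi' /eqP hj' /eqP E]].
have disj k k' : k \in SB -> k' \in SJ -> k <> k'.
  by move=> kB kJ kk; move: (disjointFr dBJ kB); rewrite kk kJ.
have sm u k k' : hF u = Some k -> hF u = Some k' -> k = k' by move=> -> [].
have: a \in [set a'; b'] by rewrite -E set21.
have: b \in [set a'; b'] by rewrite -E set22.
rewrite !inE => /orP[]/eqP eb /orP[]/eqP ea; subst.
- by case: (disj i j) => //; apply: sm hi hj.
- by case: (disj i j') => //; apply: sm hi hj'.
- by rewrite (sm _ _ _ hi hi') (sm _ _ _ hj hj').
- by case: (disj i j) => //; apply: sm hi hj.
Qed.

Lemma card_realised p : admissible p ->
  #|[set f | realised f p]| * Q ^ D <= K ^ #|slot| * Q.-1 ^ D.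
Proof.
case: p => [[hF chi] [SB SJ]] /= /and4P[dBJ /forall_inP chiI DBJ /forall_inP small].
have Q0 : 0 < Q by rewrite muln_gt0 !expn_gt0.
have := @card_blocks slot lab absent _ (enum (setX SB SJ))
   (fun k => block hF chi k.1 k.2) Q (enum_uniq _).
rewrite -cardE cardsX card_ord => H.
(* Only [D] of the [#|SB| * #|SJ|] factors (Q - 1) / Q are kept; the others are at most 1. *)
have {}H := H _ _ isT; rewrite -(subnKC DBJ) !expnD in H.
rewrite -(leq_pmul2r (m := Q ^ (#|SB| * #|SJ| - D))) ?expn_gt0 ?Q0 // -mulnA.
apply: leq_trans (H _ _) _.
- move=> k k'; rewrite !mem_enum; apply: block_disjoint => // j j' jJ j'J E jN.
  by have /forall_inP/(_ j' j'J) := chiI j jJ; rewrite E eqxx -E jN => /eqP.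
- move=> [k k']; rewrite mem_enum => /setXP[kB kJ].
  have /forall_inP/(_ _ kJ)/andP[Hb Hg] := small _ kB.
  by rewrite -[X in X ^ _](card_ord K) card_block_weight.
- by rewrite mulnA leq_mul //; case: (_ - D) => [|n] //; rewrite leq_exp2r // leq_pred.
Qed.

Definition blocked f := [exists p, admissible p && realised f p].

(** Union bound over [config]: the factors count the choices of [hF], of [chi], and of [SB] and
    [SJ]. *)
Lemma card_blocked : #|[set f | blocked f]| * Q ^ D <=
  (r.+1 ^ m.+1 * x.+1 ^ r * (2 ^ r * 2 ^ r)) * (K ^ #|slot| * Q.-1 ^ D).
Proof.
have -> : r.+1 ^ m.+1 * x.+1 ^ r * (2 ^ r * 2 ^ r) = #|config|.
  by rewrite !card_prod !card_ffun !card_option !card_ord -!cardsT -powersetT card_powerset !cardsT !card_ord.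
have : #|[set f | blocked f]| <= \sum_(p | admissible p) #|[set f | realised f p]|.
  apply: leq_trans (card_bigcup_le _ _); apply/subset_leq_card/subsetP => f.
  by rewrite inE => /existsP[p /andP[ap fp]]; apply/bigcupP; exists p; rewrite ?inE.
move=> H; apply: leq_trans (leq_mul H (leqnn _)) _.
rewrite big_distrl /= -[#|config|]sum1_card big_distrl /= big_mkcond.
by apply: leq_sum => p _; case: ifP => // /card_realised; rewrite mul1n.
Qed.

(** Labels are read in Z/K and all translated at once. Over the [K] translates each slot takes every
    label once, so the edge counts average exactly to their expectation. *)
Definition shift f (c : lab) : {ffun slot -> lab} := [ffun t => GRing.add (f t) c].

Lemma shift_inj c : injective (shift^~ c).
Proof.
move=> f g /ffunP fg; apply/ffunP => t; have := fg t; rewrite !ffunE.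
exact: GRing.addIr.
Qed.

Lemma sum_present f : \sum_c #|present (shift f c)| = x * m.+1 * K.-1 + 'C(m.+1, 2) * h.+1.
Proof.
have -> : \sum_c #|present (shift f c)| =
    \sum_c \sum_(t | is_slot t) (shift f c t \notin absent t : nat).
  apply: eq_bigr => c _; rewrite -sum1_card big_mkcond [RHS]big_mkcond /=.
  by apply: eq_bigr => t _; rewrite inE; case: (is_slot t) => //=; case: (_ \in _).
rewrite exchange_big /=.
have count t : \sum_c (shift f c t \notin absent t : nat)
    = if t is inl _ then K.-1 else h.+1.
  have -> : \sum_c (shift f c t \notin absent t : nat) = #|~: absent t|.
    rewrite -sum1_card [RHS]big_mkcond [RHS](reindex_inj (@GRing.addrI _ (f t))) /=.
    by apply: eq_bigr => c _; rewrite inE ffunE; case: (_ \in _).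
  have := cardsC (absent t); rewrite card_ord card_absent.
  by move: #|~: absent t| => n; case: t => _; rewrite -addnn; lia.
rewrite (eq_bigr _ (fun t _ => count t)) big_sumType /= sum_nat_const.
rewrite card_prod !card_ord; congr (_ + _).
rewrite sum_nat_const; congr (_ * _); rewrite -[in RHS](card_ord m.+1) -card_draws.
by apply: eq_card => e; rewrite !inE.
Qed.

(** Fewer than 1/K of the labellings are blocked, so some [f] has all its [K] translates unblocked;
    the best translate has at least the average number of edges. This replaces a concentration
    estimate. *)
Lemma exists_unblocked :
  K * (r.+1 ^ m.+1 * x.+1 ^ r * (2 ^ r * 2 ^ r)) * Q.-1 ^ D < Q ^ D ->
  exists2 f, ~~ blocked f &
    x * m.+1 * K.-1 + 'C(m.+1, 2) * h.+1 <= K * #|present f|.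
Proof.
move=> HQ; set N := _ * _ * (2 ^ r * _) in HQ.
have B : K * #|[set f | blocked f]| < K ^ #|slot|.
  have := card_blocked; rewrite -/N.
  have Q0 : 0 < Q ^ D by apply: leq_trans HQ.
  rewrite -(ltn_pmul2r Q0) -mulnA -(leq_pmul2l (ltn0Sn h.*2.+1)) => H.
  apply: leq_ltn_trans H _; rewrite !mulnA in HQ *.
  have K0 : 0 < K ^ #|slot| by rewrite expn_gt0.
  by rewrite -(ltn_pmul2l K0) in HQ; lia.
have [f fN] : exists f, f \notin \bigcup_c [set f | blocked (shift f c)].
  apply/existsP; rewrite -negb_forall; apply: contraTN B => /forallP al.
  rewrite -leqNgt -[X in X ^ _](card_ord K) -card_ffun -cardsT.
  apply: leq_trans (_ : \sum_(c : lab) #|[set f | blocked (shift f c)]| <= _).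
    by apply: leq_trans (card_bigcup_le _ _); apply/subset_leq_card/subsetP => f _; apply: al.
  rewrite -[X in _ <= X * _](card_ord K) -sum_nat_const; apply: leq_sum => c _.
  rewrite -(card_imset _ (@shift_inj c)); apply/subset_leq_card/subsetP => g.
  by case/imsetP=> g' + ->; rewrite !inE.
have : exists c, x * m.+1 * K.-1 + 'C(m.+1, 2) * h.+1 <= K * #|present (shift f c)|.
  apply/existsP; apply: contraT; rewrite negb_exists => /forallP al.
  have : \sum_(c : lab) (K * #|present (shift f c)|).+1 <=
     \sum_(c : lab) (x * m.+1 * K.-1 + 'C(m.+1, 2) * h.+1).
    by apply: leq_sum => c _; rewrite ltnNge.
  rewrite (eq_bigr _ (fun i _ => esym (addn1 _))) big_split /= -big_distrr /= sum_present.
  by rewrite !sum_nat_const card_ord; lia.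
case=> c Hc; exists (shift f c) => //; apply: contra fN => b.
by apply/bigcupP; exists c; rewrite ?inE.
Qed.
End Labelling.

(** * The host graph *)

Section Host.
Variables (x m h r : nat) (V : finType).

Notation X := 'I_x.
Notation F := 'I_m.+1.
Notation vertex := (X + nat * F)%type.
Variable f : {ffun slot x m -> 'I_(h.*2.+1).+1}.
Variable tau : V -> vertex.
Hypothesis tau_inj : injective tau.

(** This is an infinite graph: X with countably many identical copies of F. A host is its pullback
    along the injection [tau], which allows any number of vertices, the last copy of F being
    possibly incomplete. *)
Definition vertex_adj (v w : vertex) : bool :=
  match v, w with
  | inl y, inr (_, a) | inr (_, a), inl y => inl (y, a) \in present f
  | inr (c, a), inr (c', b) => (c == c') && (inr [set a; b] \in present f)
  | inl _, inl _ => false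
  end.

Lemma vertex_adjC : symmetric vertex_adj.
Proof. by move=> [y|[c a]] [y'|[c' b]] //=; rewrite eq_sym setUC. Qed.

Lemma host_subproof :
  [forall e in [set [set u; v] | u in V, v in V & vertex_adj (tau u) (tau v)], #|e| == 2].
Proof.
apply/forall_inP => _ /imset2P[u v _ + ->]; rewrite inE => /andP[_].
move=> uv; rewrite cards2 (_ : u != v) //; apply: contraTneq uv => ->.
by case: (tau v) => [//|[c a]] /=; rewrite inE /= setUid cards1 andbF.
Qed.

Definition host : graph V := Graph host_subproof.

Lemma adj_host u v : adj host u v = vertex_adj (tau u) (tau v).
Proof.
apply/imset2P/idP => [[a b _ + /set2_inj[[-> ->]|[-> ->]]]|uv].
- by rewrite inE => /andP[].
- by rewrite inE vertex_adjC => /andP[].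
- by exists u v; rewrite ?inE.
Qed.

Lemma card_host_edges q :
  (forall y, exists v, tau v = inl y) ->
  (forall c a, c < q -> exists v, tau v = inr (c, a)) ->
  q * #|present f| <= #|edges host|.
Proof.
move=> tauX tauF.
(* [on c t w] says that [w] is an end of slot [t] placed in copy [c]; [g] sends a copy and a present
   slot to the resulting edge. *)
pose on (c : nat) (t : slot x m) (w : vertex) := match t, w with
  | inl (y, _), inl y' => y == y'
  | inl (_, a), inr (c', b) => (c == c') && (a == b)
  | inr _, inl _ => false
  | inr e, inr (c', b) => (c == c') && (b \in e) end.
pose g (p : 'I_q * slot x m) := [set v | on p.1 p.2 (tau v)].
have g_inj : {in setX setT (present f) &, injective g}.
  move=> [c t] [c' t'] /setXP[_ tP] /setXP[_ t'P] /setP E.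
  have EX y : on c t (inl y) = on c' t' (inl y).
    by have [v tv] := tauX y; have := E v; rewrite !inE tv.
  have EF (d : 'I_q) a : on c t (inr (d : nat, a)) = on c' t' (inr (d : nat, a)).
    by have [v tv] := tauF d a (ltn_ord d); have := E v; rewrite !inE tv.
  case: t t' tP t'P EX EF {E} => [[y a]|e] [[y' a']|e'] tP t'P EX EF.
  - have := EX y; have := EF c a; rewrite /= !eqxx => /esym/andP[/eqP cc /eqP->].
    by move=> /esym/eqP->; rewrite (ord_inj cc).
  - by have := EX y; rewrite /= eqxx.
  - by have := EX y'; rewrite /= eqxx.
  move: tP; rewrite inE /= => /andP[/cards2P[a [b [_ ee]]] _].
  have := EF c a; rewrite /= ee !inE !eqxx /= => /esym/andP[/eqP/ord_inj cc _].
  rewrite cc -ee; congr (_, inr _); apply/setP => d.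
  by have := EF c d; rewrite /= cc eqxx.
have -> : q * #|present f| = #|setX [set: 'I_q] (present f)|.
  by rewrite cardsX cardsT card_ord.
rewrite -(card_in_imset g_inj); apply/subset_leq_card/subsetP => _ /imsetP[[c t] /setXP[_ tP] ->].
suff [u [v [uv E]]] : exists u v, vertex_adj (tau u) (tau v) /\ forall w, on c t (tau w) = (w == u) || (w == v).
  apply/imset2P; exists u v; rewrite ?inE //; apply/setP => w.
  by rewrite !inE E.
case: t tP => [[y a]|e] tP.
  have [u tu] := tauX y; have [v tv] := tauF c a (ltn_ord c).
  exists u, v; rewrite tu tv; split=> // w.
  rewrite -!(inj_eq tau_inj) tu tv; case: (tau w) => [y'|[c' b]] /=.
    by rewrite orbF eq_sym.
  by rewrite eq_sym [a == _]eq_sym.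
have := tP; rewrite inE /= => /andP[/cards2P[a [b [_ ee]]] _].
have [u tu] := tauF c a (ltn_ord c); have [v tv] := tauF c b (ltn_ord c).
exists u, v; rewrite tu tv; split=> [|w]; first by rewrite /= eqxx -ee.
rewrite -!(inj_eq tau_inj) tu tv ee; case: (tau w) => [//|[c' d]] /=.
rewrite !inE -[inr _ == inr (_, a)]/((c' == c) && (d == a)).
by rewrite -[inr _ == inr (_, b)]/((c' == c) && (d == b)) -andb_orr eq_sym.
Qed.

Lemma sum_fib (hF : {ffun F -> option 'I_r}) (SB SJ : {set 'I_r}) :
  [disjoint SB & SJ] ->
  \sum_(i in SB) #|fib hF i| + \sum_(j in SJ) #|fib hF j| <= m.+1.
Proof.
move=> dBJ; apply: leq_trans (_ : \sum_j #|fib hF j| <= _).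
  rewrite [\sum_(i in SB) _]big_mkcond [\sum_(i in SJ) _]big_mkcond -big_split /=.
  apply: leq_sum => j _; case: ifP => [jB|_]; last by case: ifP.
  by rewrite (disjointFr dBJ jB) addn0.
have -> : \sum_j #|fib hF j| = \sum_j \sum_a (hF a == Some j : nat).
  apply: eq_bigr => j _; rewrite -sum1_card big_mkcond.
  by apply: eq_bigr => a _; rewrite inE; case: eqP.
rewrite exchange_big /= -[X in _ <= X]card_ord -sum1_card; apply: leq_sum => a _.
case: (hF a) => [k|]; last by rewrite big1.
by rewrite (bigD1 k) //= eqxx big1 // => j /negPf jk; rewrite eqE /= eq_sym jk.
Qed.

(** [markov_size] keeps a fifth of each side, hence the 25 before [D], with class sizes at most 5/4
    of the averages. If u and v are the total sizes, 4 u v <= (m + 1)^2 turns this into the bound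
    [gam] on products. *)
Lemma find_admissible (D beta gam s : nat) (hF : {ffun F -> option 'I_r})
    (chi : {ffun 'I_r -> option X}) (SB SJ : {set 'I_r}) :
  0 < s -> 5 * m.+1 <= 4 * s * beta ->
  25 * m.+1 ^ 2 <= 64 * (s * (r - s)) * gam -> 25 * D <= s * (r - s) ->
  0 < s * (r - s) ->
  [disjoint SB & SJ] ->
  {in SJ &, forall j j', chi j = chi j' -> chi j != None -> j = j'} ->
  s <= #|SB| -> s * (r - s) <= #|SB| * #|SJ| ->
  exists SB' SJ' : {set 'I_r}, [/\ SB' \subset SB, SJ' \subset SJ &
    admissible D beta gam (hF, chi, (SB', SJ'))].
Proof.
move=> s0 Hbeta Hgam HD rs0 dBJ chiI sB BJ.
pose mk (S : {set 'I_r}) := [set i in S | 4 * (#|fib hF i| * #|S|) <= 5 * \sum_(i in S) #|fib hF i|].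
have mkS S : mk S \subset S by apply/subsetP => i; rewrite inE => /andP[].
have mB := markov_size SB (fun i => #|fib hF i|).
have mJ := markov_size SJ (fun i => #|fib hF i|).
have sBJ := sum_fib hF dBJ.
exists (mk SB), (mk SJ); split=> //; apply/and4P; split.
- by apply: disjointWl (mkS SB) _; apply: disjointWr (mkS SJ) _.
- apply/forall_inP => j /(subsetP (mkS _)) jJ; apply/forall_inP => j' /(subsetP (mkS _)) j'J.
  by apply/implyP => /andP[/eqP E N]; apply/eqP/chiI.
- rewrite -(leq_pmul2l (ltn0Sn 24)); apply: leq_trans HD _; apply: leq_trans BJ _.
  by apply: leq_trans (leq_mul mB mJ) _; rewrite mulnACA.
- apply/forall_inP => i; rewrite inE => /andP[iB Hi].
  apply/forall_inP => j; rewrite inE => /andP[jJ Hj].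
  move: (\sum_(i in SB) _) (\sum_(i in SJ) _) sBJ Hi Hj => u v uv Hi Hj.
  move: (#|fib hF i|) (#|fib hF j|) Hi Hj => b c Hi Hj.
  apply/andP; split.
    rewrite -(leq_pmul2l (m := 4 * s)) ?muln_gt0 ?s0 //; apply: leq_trans Hbeta.
    apply: leq_trans (leq_trans Hi _); first by rewrite -mulnA leq_mul2l mulnC leq_mul2l sB orbT.
    by rewrite leq_mul2l; lia.
  rewrite -(leq_pmul2l (m := 64 * (s * (r - s)))); last by rewrite muln_gt0.
  apply: leq_trans Hgam.
  have uv4 : 4 * (u * v) <= m.+1 ^ 2.
    by apply: leq_trans (_ : (u + v) ^ 2 <= _); [rewrite nat_AGM2|rewrite leq_sqr].
  apply: leq_trans (_ : 4 * (4 * (b * #|SB|) * (4 * (c * #|SJ|))) <= _).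
    have -> : 4 * (4 * (b * #|SB|) * (4 * (c * #|SJ|))) = 64 * (#|SB| * #|SJ|) * (b * c) by lia.
    by rewrite leq_mul2r leq_mul2l BJ !orbT.
  apply: leq_trans (_ : 4 * (5 * u * (5 * v)) <= _).
    by rewrite leq_mul2l leq_mul.
  by rewrite mulnACA [4 * _]mulnCA leq_mul2l uv4.
Qed.

Lemma card_subset_exists (T : finType) (A : {set T}) k : k <= #|A| ->
  exists2 B : {set T}, B \subset A & #|B| = k.
Proof.
move=> kA; have : 0 < #|[set B : {set T} | (B \subset A) && (#|B| == k)]|.
  by rewrite cards_draws bin_gt0.
by case/card_gt0P => B; rewrite inE => /andP[BA /eqP Bk]; exists B.
Qed.

(** Here b exceeds r + s - 2a, and the concave function a (r + s - 2a) equals s (r - s) at both ends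
    a = s and a = (r - s) / 2 of the range. *)
Lemma pair_count (N a b s : nat) : N < r - s -> 2 * r <= N + (2 * a + b) ->
  s < a -> 2 * a + s <= r -> s * (r - s) <= a * b.
Proof.
move=> Nr rab sa ar; have [d ad] : exists d, a = s + d by exists (a - s); lia.
subst a.
have [e re] : exists e, r = 2 * (s + d) + s + e by exists (r - (2 * (s + d) + s)); lia.
apply: leq_trans (_ : (s + d) * (r + s - 2 * (s + d)) <= _); last first.
  by rewrite leq_mul2l; apply/orP; right; lia.
have -> : r - s = 2 * s + 2 * d + e by lia.
have -> : r + s - 2 * (s + d) = 2 * s + e by lia.
by nia.
Qed.

(** When this many branch sets avoid X, both sides can be chosen among them; an even split gives
    ample pairs because s is at most r / 100. *)
Lemma half_pair_count (a s : nat) : 0 < s -> 100 * s <= r -> r < 2 * a + s ->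
  s <= a %/ 2 /\ s * (r - s) <= a %/ 2 * (a - a %/ 2).
Proof.
move=> s0 sr ar; split; first by lia.
have k1 : r <= 5 * (a %/ 2) by lia.
have k2 : a %/ 2 <= a - a %/ 2 by lia.
apply: leq_trans (leq_mul (leqnn _) k2); move: (a %/ 2) k1 => k k1.
apply: leq_trans (_ : s * (5 * k) <= _); first by rewrite leq_mul2l; apply/orP; right; lia.
by rewrite mulnA leq_mul2r; apply/orP; right; lia.
Qed.

Definition isX v := if tau v is inl _ then true else false.

Lemma host_no_minor (D beta gam s l : nat) :
  0 < s -> 100 * s <= r -> x < l * (r - s) -> 5 * m.+1 <= 4 * s * beta ->
  25 * m.+1 ^ 2 <= 64 * (s * (r - s)) * gam -> 25 * D <= s * (r - s) ->
  ~~ blocked r D beta gam f ->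
  ~ minor (copies l (complete 'I_r)) host.
Proof.
move=> s0 sr xl Hbeta Hgam HD fN /minor_copies_complete[B0 [B0dis B0ne B0conn B0adj]].
pose Xs := [set v | isX v].
have cardXs : #|Xs| <= x.
  pose p v : option X := if tau v is inl y then Some y else None.
  have p_inj : {in Xs &, injective p}.
    move=> v w; rewrite !inE /isX /p => vX wX E; apply: tau_inj.
    by move: vX wX E; case: (tau v) (tau w) => [y|?] [y'|?] // _ _ [->].
  have cX : #|[set Some y | y : X]| = x by rewrite card_imset ?card_ord // => ? ? [].
  rewrite -(card_in_imset p_inj) -[in leqRHS]cX; apply/subset_leq_card/subsetP => q.
  case/imsetP=> v + ->; rewrite inE /isX /p; case: (tau v) => // y _.
  by apply/imsetP; exists y.
(* Pigeonhole: the branch sets are disjoint, so the [l] copies share at most x < l (r - s) vertices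
   of X. *)
have [i Hi] : exists i, \sum_j #|B0 i j :&: Xs| < r - s.
  apply/existsP; apply: contraLR xl; rewrite negb_exists => /forallP al.
  rewrite -leqNgt; apply: leq_trans cardXs.
  apply: leq_trans (_ : \sum_i \sum_j #|B0 i j :&: Xs| <= _).
    rewrite -[l in l * _]card_ord -sum_nat_const; apply: leq_sum => i _.
    by rewrite leqNgt.
  have -> : \sum_i \sum_j #|B0 i j :&: Xs| =
      \sum_i \sum_j \sum_(v in Xs) (v \in B0 i j : nat).
    apply: eq_bigr => i _; apply: eq_bigr => j _.
    rewrite -sum1_card big_mkcond [RHS]big_mkcond; apply: eq_bigr => v _.
    by rewrite in_setI; do 2 case: (v \in _).
  rewrite pair_big exchange_big /= -sum1_card; apply: leq_sum => v _.
  case: (pickP (fun p => v \in B0 p.1 p.2)) => [[i j] /= vB|no]; last first.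
    by rewrite big1 // => p _; rewrite no.
  rewrite (bigD1 (i, j)) //= vB big1 // => -[i' j'] /eqP ij'.
  case: (boolP (v \in B0 i' j')) => // vB'; case: ij'.
  by have [-> ->] := B0dis _ _ _ _ _ vB vB'.
pose B j := B0 i j; pose n j := #|B j :&: Xs|.
pose S0 := [set j | n j == 0]; pose S1 := [set j | n j == 1].
have nsum : \sum_j n j < r - s := Hi.
have rE : r = \sum_(j : 'I_r) 1 by rewrite sum1_card card_ord.
have cE (S : {set 'I_r}) : #|S| = \sum_(j : 'I_r) (j \in S : nat).
  by rewrite -sum1_card big_mkcond; apply: eq_bigr => j _; case: (j \in S).
(* Termwise, 2 <= n + 2 [n = 0] + [n = 1]. *)
have count : 2 * r <= \sum_j n j + (2 * #|S0| + #|S1|).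
  rewrite [in leqLHS]rE !cE !big_distrr -!big_split /=.
  by apply: leq_sum => j _; rewrite !inE; case: (n j) => [|[|k]].
have count0 : r <= \sum_j n j + #|S0|.
  rewrite [in leqLHS]rE cE -big_split /=.
  by apply: leq_sum => j _; rewrite !inE; case: (n j).
clear rE; have s0S : s < #|S0| by lia.
have [j0 j0S] : exists j, j \in S0 by apply/card_gt0P; apply: leq_ltn_trans s0S.
have S0F j v : j \in S0 -> v \in B j -> exists c a, tau v = inr (c, a).
  rewrite inE cards_eq0 => /eqP nj vj.
  case E: (tau v) => [y|[c a]]; last by exists c, a.
  have : v \in B j :&: Xs by rewrite !inE vj /isX E.
  by rewrite nj inE.
have [v0 v0B] := B0ne i j0; have [c [a0 tv0]] := S0F _ _ j0S v0B.
(* [inc] marks the vertices of copy [c]. Edges avoiding X stay in one copy, so [inc] is constant on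
   each connected set of [S0], and adjacency to [B j0] carries it to all of them. *)
pose inc v := if tau v is inr (c', _) then c == c' else false.
have inc_const j u v : j \in S0 -> u \in B j -> v \in B j -> inc u = inc v.
  move=> jS; apply: (B0conn i j inc) => {}u {}v uB vB.
  have [cu [au tu]] := S0F _ _ jS uB; have [cv [av tv]] := S0F _ _ jS vB.
  by rewrite adj_host tu tv /inc tu tv => /andP[/eqP-> _].
have S0c j v : j \in S0 -> v \in B j -> exists a, tau v = inr (c, a).
  move=> jS vB; suff : inc v.
    by rewrite /inc; case: (tau v) => [//|[c' a]] /eqP->; exists a.
  have inc0 u : u \in B j0 -> inc u.
    by move=> uB; rewrite (inc_const _ _ _ j0S uB v0B) /inc tv0.
  case: (eqVneq j0 j) => [E|jj]; first by apply: inc0; rewrite E.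
  have [u [w [uB wB]]] := B0adj i _ _ jj; rewrite adj_host.
  have := inc0 _ uB; have [cw [aw tw]] := S0F _ _ jS wB.
  rewrite (inc_const _ _ _ jS vB wB) /inc tw; case: (tau u) => [//|[cu au]] /eqP->.
  by case/andP.
(* An edge leaving a set of [S0] ends in X or in copy [c], so traces on copy [c] and vertices of X
   capture all edges considered below. *)
pose hF : {ffun F -> option 'I_r} :=
  [ffun a => [pick j | [exists v in B j, tau v == inr (c, a)]]].
pose chi : {ffun 'I_r -> option X} :=
  [ffun j => [pick y | [exists v in B j, tau v == inl y]]].
have Bdis j j' v : v \in B j -> v \in B j' -> j = j'.
  by move=> v1 v2; have [] := B0dis _ _ _ _ _ v1 v2.
have hFE j v a : v \in B j -> tau v = inr (c, a) -> hF a = Some j.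
  move=> vB tv; rewrite ffunE; case: pickP => [j' /exists_inP[w wB /eqP tw]|/(_ j)]; last first.
    have H : [exists v in B j, tau v == inr (c, a)] by apply/exists_inP; exists v; rewrite ?tv.
    by rewrite /= H.
  by have E : w = v by [apply: tau_inj; rewrite tv]; rewrite E in wB; rewrite (Bdis _ _ _ wB vB).
have chiE j v y : j \in S0 :|: S1 -> v \in B j -> tau v = inl y -> chi j = Some y.
  move=> jS vB tv; rewrite ffunE; case: pickP => [y' /exists_inP[w wB /eqP tw]|/(_ y)]; last first.
    have H : [exists v in B j, tau v == inl y] by apply/exists_inP; exists v; rewrite ?tv.
    by rewrite /= H.
  have nj : n j <= 1 by move: jS; rewrite !inE => /orP[]/eqP->.
  have E : w = v by apply: (card_le1_eqP nj); rewrite !inE ?wB ?vB /isX ?tw ?tv.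
  by move: tw; rewrite E tv => -[->].
have chiI j j' : chi j = chi j' -> chi j != None -> j = j'.
  rewrite !ffunE; case: pickP => [y /exists_inP[v vB /eqP tv]|_ _ /eqP//].
  case: pickP => [y' /exists_inP[w wB /eqP tw] [E] _|//].
  have Ev : v = w by apply: tau_inj; rewrite tv tw E.
  by apply: Bdis vB _; rewrite Ev.
have [SB [SJ [dBJ SB0 SJ01 sB BJ]]] : exists SB SJ : {set 'I_r},
    [/\ [disjoint SB & SJ], SB \subset S0, SJ \subset S0 :|: S1,
        s <= #|SB| & s * (r - s) <= #|SB| * #|SJ|].
  (* Either [S0] is played against [S1], or [S0] is so large that it is split in halves. *)
  case: (leqP (2 * #|S0| + s) r) => case2.
    exists S0, S1; split; rewrite ?subsetUr //; [|exact: ltnW|exact: pair_count nsum count s0S case2].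
    rewrite -setI_eq0; apply/eqP/setP => j; rewrite !inE.
    by case: (n j) => [|[|k]].
  have [SB SB0 cSB] := card_subset_exists (leq_div #|S0| 2).
  exists SB, (S0 :\: SB); rewrite SB0 (subset_trans (subsetDl _ _) (subsetUl _ _)).
  rewrite (cardsD S0) (setIidPr SB0) cSB.
  have [sS rS] := half_pair_count s0 sr case2.
  by split; rewrite // -setI_eq0 setIDA setIC -setIDA setDv setI0.
have rs0 : 0 < s * (r - s) by rewrite muln_gt0 s0 subn_gt0; lia.
have [SB' [SJ' [sSB sSJ adm]]] := find_admissible hF s0 Hbeta Hgam HD rs0 dBJ
  (fun j j' _ _ => chiI j j') sB BJ.
case/negP: fN; apply/existsP; exists (hF, chi, (SB', SJ')); rewrite adm /=.
apply/allP => -[i1 j1]; rewrite mem_enum => /setXP[/(subsetP sSB) iB /(subsetP sSJ) jJ] /=.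
have i1S0 := subsetP SB0 _ iB; have j1S := subsetP SJ01 _ jJ.
have ij : i1 != j1 by apply: contraTneq jJ => <-; rewrite (disjointFr dBJ iB).
have [u [v [uB vB]]] := B0adj i _ _ ij; rewrite adj_host.
have [a tu] := S0c _ _ i1S0 uB; rewrite tu.
have ha := hFE _ _ _ uB tu.
case tv: (tau v) => [y|[c' b]] /=.
  rewrite inE => /andP[_ Hp]; apply/forall_inPn; exists (inl (y, a)) => //.
  by rewrite inE ha eqxx (chiE _ _ _ j1S vB tv) eqxx.
case/andP=> /eqP cc; rewrite inE => /andP[_ Hp]; apply/forall_inPn; exists (inr [set a; b]) => //.
rewrite inE; apply/existsP; exists a; apply/existsP; exists b.
by rewrite ha (hFE _ _ _ vB) ?tv ?cc // !eqxx.
Qed.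

End Host.

(** * Density *)

Lemma dense_minor_free (x m h r D beta gam s l n q : nat) :
  0 < s -> 100 * s <= r -> x < l * (r - s) -> 5 * m.+1 <= 4 * s * beta ->
  25 * m.+1 ^ 2 <= 64 * (s * (r - s)) * gam -> 25 * D <= s * (r - s) ->
  let K := (h.*2.+1).+1 in let Q := K ^ beta * 2 ^ gam in
  K * (r.+1 ^ m.+1 * x.+1 ^ r * (2 ^ r * 2 ^ r)) * Q.-1 ^ D < Q ^ D ->
  x + q * m.+1 <= n ->
  exists2 G : graph 'I_n, ~ minor (copies l (complete 'I_r)) G &
    q * (x * m.+1 * K.-1 + 'C(m.+1, 2) * h.+1) <= K * #|edges G|.
Proof.
move=> s0 sr xl Hb Hg HD K Q HQ xn.
have [f fN Hf] := exists_unblocked HQ.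
(* The first [x] indices form X; the rest is cut into consecutive runs of length m + 1, the copies
   of F. *)
pose tau (i : 'I_n) : 'I_x + nat * 'I_m.+1 :=
  if insub (val i) is Some y then inl y
  else inr ((i - x) %/ m.+1, inord ((i - x) %% m.+1)).
have tauX (i : 'I_n) (y : 'I_x) : i = y :> nat -> tau i = inl y.
  move=> iy; have ix : i < x by rewrite iy.
  by rewrite /tau (insubT (fun k => k < x) ix) /=; congr inl; apply: val_inj.
have tauF (i : 'I_n) : x <= i ->
    tau i = inr ((i - x) %/ m.+1, inord ((i - x) %% m.+1)).
  by move=> xi; rewrite /tau insubN // -leqNgt.
have tau_inj : injective tau.
  move=> i j; case: (ltnP i x) => [ix|xi].
    rewrite (tauX i (Ordinal ix)) //; case: (ltnP j x) => [jx|xj].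
      by rewrite (tauX j (Ordinal jx)) // => -[/= ij]; apply: val_inj.
    by rewrite tauF.
  rewrite (tauF i xi); case: (ltnP j x) => [jx|xj].
    by rewrite (tauX j (Ordinal jx)).
  rewrite (tauF j xj) => -[E1 /(congr1 val)]; rewrite /= !inordK ?ltn_pmod // => E2.
  apply: val_inj => /=; rewrite -(subnK xi) -(subnK xj).
  by rewrite (divn_eq (i - x) m.+1) (divn_eq (j - x) m.+1) E1 E2.
exists (host f tau); first exact (host_no_minor tau_inj s0 sr xl Hb Hg HD fN).
apply: leq_trans (leq_mul (leqnn q) Hf) _; rewrite mulnCA leq_mul2l; apply/orP; right.
apply: card_host_edges => // [y|c a cq].
  have yn : y < n by apply: leq_trans (ltn_ord y) (leq_trans (leq_addr _ _) xn).
  by exists (Ordinal yn); apply: tauX.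
have cn : x + (c * m.+1 + a) < n.
  apply: leq_trans xn; rewrite ltn_add2l; apply: leq_trans (leq_mul cq (leqnn _)).
  by rewrite mulSn addnC ltn_add2r.
exists (Ordinal cn); rewrite tauF /= ?leq_addr // addKn divnMDl // modnMDl.
by rewrite divn_small // addn0 modn_small // inord_val.
Qed.

Local Open Scope R_scope.

Lemma INR_addn a b : INR (a + b)%N = INR a + INR b.
Proof. exact: plus_INR. Qed.

Lemma INR_muln a b : INR (a * b)%N = INR a * INR b.
Proof. exact: mult_INR. Qed.

Lemma INR_expn a b : INR (a ^ b)%N = INR a ^ b.
Proof. by elim: b => // b IH; rewrite expnS INR_muln IH. Qed.

Lemma INR_leq a b : (a <= b)%N -> INR a <= INR b.
Proof. by move/leP/le_INR. Qed.

Lemma INR_ltn a b : (a < b)%N -> INR a < INR b.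
Proof. by move/ltP/lt_INR. Qed.

Lemma leq_INR a b : INR a <= INR b -> (a <= b)%N.
Proof. by move/INR_le/leP. Qed.

Lemma ltn_INR a b : INR a < INR b -> (a < b)%N.
Proof. by move/INR_lt/ltP. Qed.

Lemma le_bigRmax (I : eqType) (s : seq I) (P : pred I) (F : I -> R) i :
  i \in s -> P i -> F i <= \big[Rmax/0]_(j <- s | P j) F j.
Proof.
elim: s => // j s IH; rewrite inE big_cons => /orP[/eqP <- -> |/IH{}IH Pi].
  exact: Rmax_l.
by case: ifP => _; [apply: Rle_trans (IH Pi) (Rmax_r _ _)|exact: IH].
Qed.

Lemma le_max_density (U : finType) (H : graph U) n (G : graph 'I_n) :
  ~ minor H G -> density G <= max_density H n.
Proof.
move=> NG; rewrite /max_density.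
by apply: (@le_bigRmax _ _ _ (@density 'I_n)); rewrite ?mem_index_enum //; apply/asboolP.
Qed.

(** Per vertex of a copy of F there are x (1 - 1/K) edges to X and m / 4 inside. At most x + m + 1
    vertices lie outside the complete copies, and the strict inequality on [d] absorbs them for
    large n. *)
Lemma c_infty_copies_ge (x m h r D beta gam s l : nat) (d : R) :
  (0 < s)%N -> (100 * s <= r)%N -> (x < l * (r - s))%N -> (5 * m.+1 <= 4 * s * beta)%N ->
  (25 * m.+1 ^ 2 <= 64 * (s * (r - s)) * gam)%N -> (25 * D <= s * (r - s))%N ->
  let K := (h.*2.+1).+1 in let Q := (K ^ beta * 2 ^ gam)%N in
  (K * (r.+1 ^ m.+1 * x.+1 ^ r * (2 ^ r * 2 ^ r)) * Q.-1 ^ D < Q ^ D)%N ->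
  d < INR x * (1 - / INR K) + INR m / 4 ->
  Rbar_le d (c_infty (copies l (complete 'I_r))).
Proof.
move=> s0 sr xl Hb Hg HD K Q HQ; set v := (X in _ < X) => dv.
rewrite -(Lim_seq_const d); apply: Lim_seq_le_loc.
have K0 : 0 < INR K by apply: (lt_INR 0); apply/ltP.
have K1 : / INR K <= 1.
  by rewrite -[1]Rinv_1; apply: Rinv_le_contravar; [lra|rewrite -[1]/(INR 1); apply: le_INR; apply/leP].
have v0 : 0 <= v by have := pos_INR x; have := pos_INR m; rewrite /v; nra.
have [N HN] := INR_unbounded (Rmax 0 (INR (x + m.+1) * v / (v - d))).
exists (N + x).+1 => n /leP Nn.
have n0 : 0 < INR n by apply: (lt_INR 0); apply/ltP; lia.
pose q := ((n - x) %/ m.+1)%N.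
have xq : (x + q * m.+1 <= n)%N by have := leq_trunc_div (n - x) m.+1; rewrite -/q; lia.
have [G NG HG] := dense_minor_free s0 sr xl Hb Hg HD HQ xq.
apply: Rle_trans (le_max_density NG).
rewrite /density card_ord; apply/Rle_div_r => //.
have nq : INR n <= INR (x + m.+1) + INR q * INR m.+1.
  rewrite -INR_muln -INR_addn; apply: le_INR; apply/leP.
  by have := divn_eq (n - x) m.+1; have := ltn_pmod (n - x) (ltn0Sn m); rewrite -/q; lia.
have c2 : INR 'C(m.+1, 2) * 2 = INR m.+1 * INR m.
  rewrite -(INR_muln _ 2) -INR_muln; congr INR.
  by rewrite mulnC -(mul_bin_diag m.+1 1) bin1.
have KE : INR K = 2 * INR h.+1.
  by rewrite -(INR_muln 2); congr INR; rewrite /K -addnn; lia.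
have KP : INR K.-1 = INR K - 1 by rewrite (S_INR K.-1); lra.
have EG : INR q * INR m.+1 * v <= INR #|edges G|.
  have : INR q * (INR x * INR m.+1 * INR K.-1 + INR 'C(m.+1, 2) * INR h.+1) <= INR K * INR #|edges G|.
    by rewrite -!INR_muln -INR_addn -!INR_muln; apply: le_INR; apply/leP.
  have -> : INR q * (INR x * INR m.+1 * INR K.-1 + INR 'C(m.+1, 2) * INR h.+1)
     = INR K * (INR q * INR m.+1 * v).
    rewrite KP (_ : INR 'C(m.+1, 2) = INR m.+1 * INR m / 2) ?/v; last lra.
    by rewrite (_ : INR h.+1 = INR K / 2); [field; lra|lra].
  by move/(Rmult_le_reg_l _ _ _ K0).
have Nn' : INR (x + m.+1) * v / (v - d) <= INR n.
  apply: Rle_trans (Rmax_r 0 _) _; apply: Rlt_le; apply: Rlt_le_trans HN _.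
  by apply: le_INR; lia.
have : INR (x + m.+1) * v <= INR n * (v - d) by apply/Rle_div_l; lra.
have := Rmult_le_compat_r v _ _ v0 nq.
by lra.
Qed.

(** * Choice of the parameters *)

Lemma exp_pow (y : R) n : exp y ^ n = exp (INR n * y).
Proof.
elim: n => [|n IH]; first by rewrite Rmult_0_l exp_0.
by rewrite /= IH -exp_plus -/(INR n.+1) S_INR; congr exp; ring.
Qed.

Lemma exp_le (a b : R) : a <= b -> exp a <= exp b.
Proof. by case=> [/exp_increasing/Rlt_le|->] //; apply: Rle_refl. Qed.

Lemma pow_le_exp (a y c : R) n : 0 <= a -> a <= exp y -> INR n * y <= c -> a ^ n <= exp c.
Proof.
move=> a0 ay nc; apply: Rle_trans (pow_incr _ _ n (conj a0 ay)) _.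
by rewrite exp_pow; apply: exp_le.
Qed.

(** Since 1 - 1/Q <= e^(-1/Q), the left side is at most e^(y - D/Q) Q^D. *)
Lemma union_bound_ln (N Q D : nat) (y : R) : (0 < Q)%N ->
  INR N <= exp y -> y < INR D / INR Q -> (N * Q.-1 ^ D < Q ^ D)%N.
Proof.
move=> Q0 Ny yD; apply: ltn_INR; rewrite INR_muln !INR_expn.
have q0 : 0 < INR Q by apply: (INR_ltn Q0).
have Q1 : INR Q.-1 = INR Q - 1 by rewrite -[in RHS](prednK Q0) S_INR; lra.
have H : INR Q.-1 <= INR Q * exp (- / INR Q).
  have := exp_ineq1_le (- / INR Q); have : INR Q * / INR Q = 1 by field; lra.
  by rewrite Q1; nra.
have := pow_incr _ _ D (conj (pos_INR _) H).
rewrite Rpow_mult_distr exp_pow => HD.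
have p0 : 0 < INR Q ^ D by apply: pow_lt.
apply: Rle_lt_trans (Rmult_le_compat _ _ _ _ (pos_INR _) (pow_le _ _ (pos_INR _)) Ny HD) _.
rewrite (_ : _ * _ = INR Q ^ D * (exp y * exp (INR D * - / INR Q))); last ring.
rewrite -exp_plus -[X in _ < X]Rmult_1_r; apply: Rmult_lt_compat_l => //.
rewrite -exp_0; apply: exp_increasing.
by move: yD; rewrite /Rdiv; lra.
Qed.

Lemma ex_ceil (y : R) : 0 <= y -> exists n : nat, y <= INR n <= y + 1.
Proof. by case/nfloor_ex => n Hn; exists n.+1; rewrite S_INR; lra. Qed.

(** The rational 3/4 stands in for log 2; it suffices that (35/32)^8 >= 2. *)
Lemma exp_34 : 2 <= exp (3 / 4).
Proof.
have -> : exp (3 / 4) = exp (3 / 32) ^ 8.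
  by rewrite exp_pow; congr exp; rewrite INR_IZR_INZ /=; lra.
have := exp_ineq1_le (3 / 32) => H.
by apply: Rle_trans (pow_incr (35 / 32) _ 8 _); [rewrite /=; lra|lra].
Qed.

Lemma INR_literals :
  ((INR 4 = 4) * (INR 5 = 5) * (INR 25 = 25) * (INR 64 = 64) * (INR 100 = 100))%type.
Proof. by rewrite !INR_IZR_INZ. Qed.

Lemma ex_ceil_div (a b : nat) : (0 < b)%N ->
  exists2 c : nat, (a <= b * c)%N & INR c <= INR a / INR b + 1.
Proof.
move=> b0; have b0' : 0 < INR b by apply: (INR_ltn b0).
have [c [c1 c2]] := ex_ceil (Rle_mult_inv_pos _ _ (pos_INR a) b0').
exists c => //; apply: leq_INR; rewrite INR_muln Rmult_comm.
by apply/Rle_div_l.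
Qed.

Section LargeCase.
Variables r l : nat.
Let n := INR r.
Let k := INR l.
Let L := ln n.
Hypothesis l0 : (0 < l)%N.
Hypothesis L1000 : 1000 <= L.
Hypothesis L3 : 4000 * L ^ 3 < exp (L / 10).
Hypothesis kL : k * ln L <= / 1000 * L.
Hypothesis k2 : 100 * L <= k ^ 2.

(** Let B = n L / k and A = B / k. With m + 1 near 0.4 B and s near 0.06 A, shrinking X costs k s,
    about 0.06 B, while F brings m / 4, about 0.1 B; the net 0.04 B exceeds B / 27. The same
    constants give Q <= n^0.9 against D >= n^2 / L. *)
Lemma c_infty_copies_large :
  Rbar_le (k * n + n * L / k / 27) (c_infty (copies l (complete 'I_r))).
Proof.
have k1 : 1 <= k by apply: (INR_leq l0).
have n0 : 0 < n.
  case: (Rle_lt_dec n 0) => // nn; move: L1000; rewrite /L /ln.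
  by case: (Rlt_dec 0 n) => ? ?; lra.
have nE : n = exp L by rewrite exp_ln.
have lnL1 : 1 <= ln L.
  rewrite -[1]ln_exp; apply: ln_le; first exact: exp_pos.
  by have := exp_le_3; lra.
have lnL2 : ln L <= k * ln L by nra.
have kL1 : k <= / 1000 * L by nra.
have n10 : exp (L / 10) <= n by rewrite nE; apply: exp_le; lra.
have LL : 1000 * L <= L ^ 2 by nra.
have LLL : 1000 * L ^ 2 <= L ^ 3 by rewrite (_ : L ^ 3 = L * L ^ 2); [nra|ring].
have nL : 4000000000 * L <= n by lra.
pose B := n * L / k; pose A := B / k.
have kB : k * B = n * L by rewrite /B; field; lra.
have kA : k * A = B by rewrite /A; field; lra.
have nL0 : 0 < n * L by apply: Rmult_lt_0_compat; lra.
have B0 : 1000 * n <= B.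
  apply: (Rmult_le_reg_l k); first lra.
  by rewrite kB; have := Rmult_le_compat_l n _ _ (Rlt_le _ _ n0) kL1; lra.
have Bn : B <= n * L.
  apply: (Rmult_le_reg_l k); first lra.
  by rewrite kB; have := Rmult_le_compat_r (n * L) _ _ (Rlt_le _ _ nL0) k1; lra.
have A00 : 0 < A by apply: Rdiv_lt_0_compat; lra.
(* [k2] enters here, to make [A], and with it [s], small compared with [n]. *)
have AR : 100 * A <= n.
  apply: (Rmult_le_reg_r L); first lra.
  have := Rmult_le_compat_r A _ _ ltac:(lra) k2.
  by rewrite (_ : k ^ 2 * A = n * L); [lra|rewrite -kB -kA; ring].
have A0 : 1000000 * n <= A * L.
  by have := Rmult_le_compat_l A _ _ ltac:(lra) kL1; lra.
have [s [sl su]] := ex_ceil (y := 6 / 100 * A) ltac:(lra).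
have [m' [ml mu]] := nfloor_ex (4 / 10 * B) ltac:(lra).
case: m' ml mu => [|m] ml mu; first by move: mu; rewrite /=; lra.
have s0 : (0 < s)%N by apply: ltn_INR; rewrite /=; lra.
have sr1 : 1000 * INR s <= n by lra.
have sr : (100 * s <= r)%N.
  apply: leq_INR; rewrite INR_muln INR_literals -/n; lra.
have sr' : (s <= r)%N by lia.
have rsE : INR (r - s) = n - INR s by rewrite -minus_INR //; apply/leP.
pose t := (s * (r - s))%N.
have tE : INR t = INR s * (n - INR s) by rewrite INR_muln rsE.
have t1 : 599 / 10000 * (A * n) <= INR t.
  have u1 : 999 / 1000 * n <= n - INR s by lra.
  have u2 : 0 <= 6 / 100 * A by lra.
  have u3 : 0 <= 999 / 1000 * n by lra.
  have An0 : 0 < A * n by apply: Rmult_lt_0_compat.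
  by have := Rmult_le_compat _ _ _ _ u2 u3 sl u1; rewrite tE; lra.
have An : 0 < A * n by apply: Rmult_lt_0_compat.
have AnL : 0 < A * n * L by apply: Rmult_lt_0_compat; lra.
have S0 : 0 < INR s by lra.
have T0 : 0 < INR t by lra.
have M0 : 0 < INR m.+1 by apply: (INR_ltn (ltn0Sn m)).
have s4 : (0 < 4 * s)%N by rewrite muln_gt0.
have t64 : (0 < 64 * t)%N by rewrite muln_gt0 //; apply: ltn_INR.
have [beta Hb bu] := ex_ceil_div (5 * m.+1) s4.
have [gam Hg gu] := ex_ceil_div (25 * m.+1 ^ 2) t64.
rewrite !INR_muln !INR_literals in bu; rewrite (INR_muln 25) INR_expn (INR_muln 64) !INR_literals in gu.
have [D [Dl Du]] := nfloor_ex (INR t / 25) ltac:(lra).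
(* With h + 1 about L^2, K = 2 (h + 1) exceeds k, so absent pairs between X and F cost at most n in
   density, while K <= L^3 keeps K^beta below e^(0.03 L). *)
have [a [al au]] := ex_ceil (y := L ^ 2) ltac:(nra).
case: a al au => [|h] al au; first by move: al; rewrite /=; nra.
have xl : ((l * (r - s)).-1 < l * (r - s))%N.
  by rewrite prednK // muln_gt0 l0 subn_gt0; lia.
have xE : INR (l * (r - s)).-1 = k * (n - INR s) - 1.
  by rewrite -rsE -INR_muln -[in RHS](ltn_predK xl) S_INR; lra.
have HD : (25 * D <= s * (r - s))%N.
  by apply: leq_INR; rewrite INR_muln -/t INR_literals; lra.
have KE : INR (h.*2.+2) = 2 * INR h.+1.
  by rewrite -(INR_muln 2); congr INR; rewrite -addnn; lia.
have KL : INR (h.*2.+2) <= L ^ 3 by rewrite KE; lra.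
have lnL3 : L ^ 3 = exp (3 * ln L).
  by rewrite -{1}(exp_ln L) ?exp_pow /=; [congr exp; ring|lra].
pose Q := ((h.*2.+2) ^ beta * 2 ^ gam)%N.
have Q0 : (0 < Q)%N by rewrite muln_gt0 !expn_gt0.
have betaL : INR beta * (3 * ln L) <= 3 / 100 * L.
  have b1 : 5 * INR m.+1 / (4 * INR s) <= 84 / 10 * k.
    have kS := Rmult_le_compat_l k _ _ ltac:(lra) sl.
    by apply/Rle_div_l; lra.
  have b2 : INR beta <= 84 / 10 * k + 1 by lra.
  have := Rmult_le_compat_r (3 * ln L) _ _ ltac:(lra) b2.
  by lra.
(* The constant is 25 * 0.16 / (64 * 0.0599) < 1.05, and 1.05 * 3/4 < 0.85 leaves room for
   rounding. *)
have gamL : INR gam * (3 / 4) <= 85 / 100 * L.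
  have : 25 * INR m.+1 ^ 2 / (64 * INR t) <= 105 / 100 * L.
    apply/Rle_div_l; first lra.
    have M2 : INR m.+1 ^ 2 <= 16 / 100 * (A * n * L).
      have -> : A * n * L = B ^ 2 by rewrite -kA Rmult_assoc -kB -kA; ring.
      have := pow_incr _ _ 2 (conj (Rlt_le _ _ M0) ml); lra.
    by have := Rmult_le_compat_r L _ _ ltac:(lra) t1; lra.
  lra.
have QL : INR Q <= exp (9 / 10 * L).
  rewrite INR_muln !INR_expn.
  apply: Rle_trans (_ : exp (3 / 100 * L) * exp (85 / 100 * L) <= _); last first.
    by rewrite -exp_plus; apply: exp_le; lra.
  apply: Rmult_le_compat; try (apply: pow_le; exact: pos_INR).
    by apply: pow_le_exp betaL; [exact: pos_INR|rewrite -lnL3].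
  by apply: pow_le_exp gamL; [exact: pos_INR|exact: exp_34].
have DL : n ^ 2 <= INR D * L.
  have d1 : INR t <= 25 * (INR D + 1) by lra.
  have d2 := Rmult_le_compat_r L _ _ ltac:(lra) d1.
  have d3 := Rmult_le_compat_r L _ _ ltac:(lra) t1.
  have d4 := Rmult_le_compat_r n _ _ ltac:(lra) A0.
  have d5 : n * L <= n * n by apply: Rmult_le_compat_l; lra.
  have d6 : n * 1 <= n * L by apply: Rmult_le_compat_l; lra.
  by lra.
have nn : 2 * n <= n * n by apply: Rmult_le_compat_r; lra.
have kn : k * n <= n * n by apply: Rmult_le_compat_r; lra.
have ks0 : 0 <= k * INR s by apply: Rmult_le_pos; lra.
apply: (@c_infty_copies_ge _ m h r D beta gam s l _ s0 sr xl Hb Hg HD).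
  (* The exponent collects K <= e^(3 L), r + 1 and x + 1 <= n^2 = e^(2 L), and 2 <= e. *)
  apply: (@union_bound_ln _ _ _ (3 * L + (INR m.+1 * (2 * L) + n * (2 * L) + 2 * n))) => //.
    have r2 : n * n = exp (2 * L) by rewrite nE -exp_plus; congr exp; lra.
    rewrite !INR_muln !INR_expn (exp_plus (3 * L)) (exp_plus (_ + _)) (exp_plus (_ * _)).
    apply: Rmult_le_compat; [exact: pos_INR| |apply: Rle_trans KL _; rewrite lnL3; apply: exp_le; lra|].
      by rewrite -!INR_expn -!INR_muln; apply: pos_INR.
    apply: Rmult_le_compat; try (by rewrite -!INR_expn -?INR_muln; apply: pos_INR).
      apply: Rmult_le_compat; try (by rewrite -!INR_expn; apply: pos_INR).
        apply: pow_le_exp (Rle_refl _); first exact: pos_INR.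
        by rewrite -r2 S_INR -/n; lra.
      apply: pow_le_exp (Rle_refl _); first exact: pos_INR.
      by rewrite -r2 S_INR xE; lra.
    rewrite (_ : 2 * n = n + n) ?exp_plus; last lra.
    have e2 : INR 2 ^ r <= exp n.
      apply: (@pow_le_exp _ 1); [exact: pos_INR| |rewrite -/n; lra].
      by have := exp_ineq1_le 1; rewrite /=; lra.
    by apply: Rmult_le_compat => //; apply: pow_le; exact: pos_INR.
  have q0 : 0 < INR Q by apply: (INR_ltn Q0).
  apply/Rlt_div_r => //.
  have y1 : 3 * L + (INR m.+1 * (2 * L) + n * (2 * L) + 2 * n) <= 4000 * L ^ 2 * n.
    have h1 : INR m.+1 * L <= (4 / 10 * (n * L)) * L by apply: Rmult_le_compat_r; lra.
    have h2 : n * 1000 <= n * L by apply: Rmult_le_compat_l; lra.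
    have h3 : n * L * 1000 <= n * L * L by apply: Rmult_le_compat_l; lra.
    by lra.
  have y0 : 0 <= 3 * L + (INR m.+1 * (2 * L) + n * (2 * L) + 2 * n).
    have : 0 <= INR m.+1 * L by apply: Rmult_le_pos; lra.
    by lra.
  (* After multiplication by L the left side is at most 4000 L^3 e^(0.9 L) n, which [L3] puts below
     e^(L/10) e^(0.9 L) n = n^2 <= D L. *)
  apply: Rle_lt_trans (Rmult_le_compat _ _ _ _ y0 (pos_INR _) y1 QL) _.
  apply: (Rmult_lt_reg_r L); first lra.
  apply: Rlt_le_trans DL.
  have -> : 4000 * L ^ 2 * n * exp (9 / 10 * L) * L = 4000 * L ^ 3 * exp (9 / 10 * L) * n by ring.
  rewrite (_ : n ^ 2 = exp (L / 10) * exp (9 / 10 * L) * n); last first.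
    by rewrite -exp_plus (_ : L / 10 + 9 / 10 * L = L) -?nE; [ring|lra].
  apply: Rmult_lt_compat_r => //; apply: Rmult_lt_compat_r => //; exact: exp_pos.
(* The margin (1/25 - 1/27) B is at least 2 n because B >= 1000 n; it absorbs the rounding and the
   loss from 1/K. *)
rewrite xE -/B.
have Kk : k <= INR h.*2.+2 by rewrite KE; lra.
have K0 : 0 < / INR h.*2.+2 by apply: Rinv_0_lt_compat; lra.
have KK : k * n * / INR h.*2.+2 <= n.
  by apply/Rle_div_l; [lra|have := Rmult_le_compat_l n _ _ ltac:(lra) Kk; lra].
have ks : k * INR s <= k * (6 / 100 * A + 1) by apply: Rmult_le_compat_l; lra.
have kSK : 0 <= k * INR s * / INR h.*2.+2 by apply: Rmult_le_pos; lra.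
have mm : INR m = INR m.+1 - 1 by rewrite S_INR; lra.
by lra.
Qed.
End LargeCase.

(** * The bound on lambda and the asymptotic statement *)

Lemma lambda_fun_sqr_le (a : R) : 0 < a -> lambda_fun a ^ 2 <= 4 / 27.
Proof.
move=> a0; have sa := sqrt_lt_R0 _ a0; have ss := sqrt_sqrt a (Rlt_le _ _ a0).
have -> : lambda_fun a ^ 2 = (1 - exp (- a)) ^ 2 / (4 * a).
  rewrite /lambda_fun; move: (exp (- a)) => e; rewrite -[in RHS]ss; field; lra.
apply/Rle_div_l; first lra.
have e0 := exp_pos (- a); have e1 : exp (- a) < 1.
  by rewrite -exp_0; apply: exp_increasing; lra.
(* For a > 2 the trivial bound 1 - e^(-a) < 1 suffices, as 16 a / 27 > 1. *)
case: (Rle_lt_dec a 2) => a2; last first.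
  have := pow_incr (1 - exp (- a)) 1 2 ltac:(lra); lra.
(* Squaring 1 - a/2 <= e^(-a/2), legitimate for a <= 2, yields 1 - e^(-a) <= a - a^2 / 4. *)
have e2 : (1 - a / 2) ^ 2 <= exp (- a).
  have -> : exp (- a) = exp (- (a / 2)) ^ 2 by rewrite exp_pow /=; congr exp; field.
  by apply: pow_incr; have := exp_ineq1_le (- (a / 2)); lra.
have H := pow_incr (1 - exp (- a)) (a - a ^ 2 / 4) 2 ltac:(lra).
(* [a = 4 / 3] is the critical point of [a (4 - a)^2]. *)
have E : 256 - 27 * (a * (4 - a) ^ 2) = (3 * a - 4) ^ 2 * (16 - 3 * a) by ring.
have P : 0 <= a * ((3 * a - 4) ^ 2 * (16 - 3 * a)).
  by apply: Rmult_le_pos; [lra|apply: Rmult_le_pos; [apply: pow2_ge_0|lra]].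
by rewrite -E in P; lra.
Qed.

(** The fourth power of y / 40 <= e^(y/40) gives y^4 / 2560000 <= e^(y/10), and 4000 * 2560000 is
    below the threshold on y. *)
Lemma cube_lt_exp (y : R) : 20000000000 <= y -> 4000 * y ^ 3 < exp (y / 10).
Proof.
move=> y0; have -> : exp (y / 10) = exp (y / 40) ^ 4.
  by rewrite exp_pow INR_literals; congr exp; field.
have H := pow_incr (y / 40) (exp (y / 40)) 4 ltac:(have := exp_ineq1_le (y / 40); lra).
apply: Rlt_le_trans H; have y3 : 0 < y ^ 3 by apply: pow_lt; lra.
have := Rmult_le_compat_r (y ^ 3) _ _ (Rlt_le _ _ y3) y0.
by rewrite (_ : (y / 40) ^ 4 = y * y ^ 3 / 2560000); [lra|field].
Qed.

Theorem theorem1p8 (lambda : R)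
  (hlambda : is_max_on_pos lambda_fun lambda)
  (l : nat -> nat)
  (hpos : forall r : nat, (0 < r)%N -> (0 < l r)%N)
  (hlarge : is_lim_seq (fun r : nat => INR (l r) / sqrt (ln (INR r))) p_infty)
  (hsmall : is_lim_seq
     (fun r : nat => INR (l r) * ln (ln (INR r)) / ln (INR r)) 0) :
  forall eta : R, 0 < eta ->
  exists r0 : nat, forall r : nat, (r0 <= r)%N ->
    Rbar_le
      (INR (l r) * INR r +
       (1 - eta) * (lambda ^ 2 * INR r * ln (INR r) / (4 * INR (l r))))
      (c_infty (copies (l r) (complete 'I_r))).
Proof.
move=> eta eta0.
have [[a a0 aE] _] := hlambda; have lam2 := lambda_fun_sqr_le a0; rewrite aE in lam2.
have lnlim : is_lim_seq (fun r => ln (INR r)) p_infty.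
  by apply: (is_lim_comp_seq _ _ _ p_infty is_lim_ln_p _ is_lim_seq_INR); exists 0%N.
(* The thresholds serve [cube_lt_exp], then 100 L = (10 sqrt L)^2 in [k2], then the 1/1000 in
   [kL]. *)
have [N1 H1] := proj2 (is_lim_seq_spec _ p_infty) lnlim 20000000000.
have [N2 H2] := proj2 (is_lim_seq_spec _ p_infty) hlarge 10.
have eps0 : 0 < / 1000 by lra.
have [N3 H3] := proj2 (is_lim_seq_spec _ 0) hsmall (mkposreal _ eps0).
exists (N1 + N2 + N3).+1 => r /leP Nr.
have {}H1 := H1 r ltac:(lia); have {}H2 := H2 r ltac:(lia); have {}H3 := H3 r ltac:(lia).
have r0 : (0 < r)%N by lia.
have l0 := hpos r r0; have l0' : 0 < INR (l r) by apply: (INR_ltn l0).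
move: H1 H2 H3; set L := ln (INR r) => H1 H2 H3; rewrite /= in H3.
have sL : 0 < sqrt L by apply: sqrt_lt_R0; lra.
have kL : INR (l r) * ln L <= / 1000 * L.
  have /Rabs_def2[H4 _] := H3.
  by apply/Rle_div_l; lra.
have k2 : 100 * L <= INR (l r) ^ 2.
  have k10 : 10 * sqrt L <= INR (l r) by apply/Rle_div_r; lra.
  have k0 : 0 <= 10 * sqrt L by lra.
  have := pow_incr _ _ 2 (conj k0 k10).
  by rewrite Rpow_mult_distr -(Rsqr_pow2 (sqrt L)) Rsqr_sqrt; lra.
have L1 : 1000 <= L by lra.
have L3 : 4000 * L ^ 3 < exp (L / 10) by apply: cube_lt_exp; lra.
apply: (Rbar_le_trans _ _ _ _ (c_infty_copies_large l0 L1 L3 kL k2)); rewrite -/L.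
have W0 : 0 < INR r * L / INR (l r).
  by apply: Rdiv_lt_0_compat => //; apply: Rmult_lt_0_compat; [apply: (INR_ltn r0)|lra].
rewrite /Rbar_le (_ : lambda ^ 2 * INR r * L / (4 * INR (l r)) =
  lambda ^ 2 * (INR r * L / INR (l r)) / 4); last by field; lra.
(* As lambda^2 / 4 <= 1 / 27, the gain obtained covers the full main term, and the term in [eta]
   only lowers the target. *)
have h1 := Rmult_le_compat_r _ _ _ (Rlt_le _ _ W0) lam2.
have h2 : 0 <= eta * (lambda ^ 2 * (INR r * L / INR (l r))).
  by apply: Rmult_le_pos; [lra|apply: Rmult_le_pos; [apply: pow2_ge_0|lra]].
by lra.
Qed.
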